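(* Let $\Gamma$ be a distance-regular graph with valency $k$ and diameter $D\geq 4$. If $\Gamma$ contains a quadrangle (an induced subgraph isomorphic to the $4$-cycle), then $c_2\leq \frac{2}{D}k$. Moreover, equality $c_2=\frac{2}{D}k$ holds if and only if either $D=4$ and $\Gamma$ is a Hadamard graph, or $D\geq 5$ and $\Gamma$ is the $D$-cube.
   Context: A connected graph $\Gamma$ with diameter $D$ is distance-regular if there are integers $b_i,c_i$ ($0\le i\le D$) such that for any two vertices $x,y$ at distance $i$, exactly $c_i$ neighbours of $y$ are at distance $i-1$ from $x$ and exactly $b_i$ neighbours of $y$ are at distance $i+1$ from $x$ (with $b_D=c_0=0$). It is regular of valency $k=b_0$, and $a_i=k-b_i-c_i$. The numbers $c_i$ are intersection numbers; in particular $c_2$ is the number of common neighbours of two vertices at distance $2$. A Hadamard graph is a distance-regular graph with intersection array $\{b_0,b_1,b_2,b_3;c_1,c_2,c_3,c_4\}=\{k,k-1,\frac{k}{2},1;1,\frac{k}{2},k-1,k\}$. The $D$-cube is the graph on $\{0,1\}^D$ with two vectors adjacent iff they differ in exactly one coordinate. *)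

(* Defs.v *)
From mathcomp Require Import all_boot all_order all_algebra.

Set Implicit Arguments.
Unset Strict Implicit.
Unset Printing Implicit Defensive.

(* A graph is a finType of vertices with a Boolean adjacency relation.  A
   distance-regular graph has finite valency and finite diameter, so
   restricting to finitely many vertices loses no generality. *)
Definition simple_graph (T : finType) (e : rel T) : Prop :=
  symmetric e /\ irreflexive e.

Definition connected_graph (T : finType) (e : rel T) : Prop :=
  forall x y, connect e x y.

Definition walk (T : finType) (e : rel T) (n : nat) (x y : T) : bool :=
  [exists p : n.-tuple T, path e x p && (last x p == y)].

(* Least length of a walk from x to y.  Shortest walks have fewer than #|T|
   edges; the value is #|T| when y is not reachable from x. *)
Definition gdist (T : finType) (e : rel T) (x y : T) : nat :=
  find (fun n => walk e n x y) (iota 0 #|T|).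

Definition diameter (T : finType) (e : rel T) : nat :=
  \max_(x : T) \max_(y : T) gdist e x y.

(* For i = 0 no z satisfies (gdist e x z).+1 = i, and for i = diameter e none
   satisfies gdist e x z = i.+1, so c 0 = 0 and b (diameter e) = 0 are
   enforced.  The values of b and c beyond the diameter are irrelevant. *)
Definition distance_regular_with (T : finType) (e : rel T) (b c : nat -> nat)
    : Prop :=
  connected_graph e /\
  forall (i : nat) (x y : T), i <= diameter e -> gdist e x y = i ->
    #|[set z | e y z & (gdist e x z).+1 == i]| = c i /\
    #|[set z | e y z & gdist e x z == i.+1]| = b i.

(* bs = {b_0, ..., b_(D-1)} and cs = {c_1, ..., c_D}: the array of c starts at
   index 1, hence the leading 0 = c_0; nth returns b_D = 0 by default. *)
Definition has_intersection_array (T : finType) (e : rel T) (bs cs : seq nat)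
    : Prop :=
  [/\ size bs = diameter e, size cs = diameter e
    & distance_regular_with e (nth 0 bs) (nth 0 (0 :: cs))].

Definition hadamard_graph (T : finType) (e : rel T) : Prop :=
  exists2 k : nat, ~~ odd k &
    has_intersection_array e [:: k; k.-1; k./2; 1] [:: 1; k./2; k.-1; k].

Definition graph_iso (T U : finType) (e : rel T) (f : rel U) : Prop :=
  exists2 h : T -> U, bijective h & forall x y, f (h x) (h y) = e x y.

Definition contains_induced (T U : finType) (e : rel T) (f : rel U) : Prop :=
  exists2 h : U -> T, injective h & forall u v, e (h u) (h v) = f u v.

Definition cycle_graph (n : nat) : rel 'I_n :=
  fun i j => (j == ordS i) || (i == ordS j).

Definition contains_quadrangle (T : finType) (e : rel T) : Prop :=
  contains_induced e (@cycle_graph 4).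

Definition cube_graph (D : nat) : rel {ffun 'I_D -> bool} :=
  fun x y => #|[set i | x i != y i]| == 1.

(* Main.v *)
Require Import Defs.
From mathcomp Require Import all_boot all_order all_algebra zify ring lra.

Set Implicit Arguments.
Unset Strict Implicit.
Unset Printing Implicit Defensive.

(** Write [k = b_0] and [a_1 = k - b_1 - 1]; a quadrangle forces [c_2 >= 2].

    If [a_1 <= c_2], fix a vertex [x] and a level [j].  Two distinct vertices
    [u], [v] at distance [j] from [x] have [m] common neighbours at distance
    [j - 1] and [n] at distance [j + 1] from [x], with [m + n <= c_2].  The sums
    of [m], [n] and [m n] over all pairs [u], [v] are determined by the
    intersection numbers, so the pointwise inequalities
    [m n <= (c_2 - 1) m], [m n <= (c_2 - 1) n] and [4 m n <= c_2 (m + n)] yield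
    [b_j < b_(j-1)], [c_j < c_(j+1)] and, for [2 <= j <= D - 2],
    [(b_(j-1) - b_j) + (c_(j+1) - c_j) >= 2 c_2 - 2].  Summing over [j] gives
    [2 k >= D c_2 + (D - 4) (c_2 - 2)].  Equality leaves the Hadamard array when
    [D = 4], and [c_2 = 2], [c_i = i], [b_i = D - i] when [D >= 5].  In the latter
    case [v |-> {y ~ x | d(y, v) < d(x, v)}] maps onto the subsets of the [D]
    neighbours of [x], and the graph has [sum_i 'C(D, i) = 2 ^ D] vertices.

    If [a_1 > c_2], Terwilliger's inequality
    [(c_(i+1) - b_(i+1)) - (c_i - b_i) >= a_1 + 2] telescopes to
    [2 k >= D (a_1 + 2) > D c_2].  To prove it, let [s(u)] and [t(u)] be the
    alternating sums over a quadrangle [v_1, ..., v_4] of the distances [d(v_j, u)]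
    and of the indicators of [d(v_j, u) <= i].  Then [s(u) t(u) <= 0] for all [u],
    and evaluating [\sum_u s(u) t(u)] in the adjacency algebra gives a positive
    multiple of [a_1 + 2 - (c_(i+1) - b_(i+1)) + (c_i - b_i)]. *)

(** * The graph metric *)

Definition nbrs (T : finType) (e : rel T) (x : T) : {set T} := [set y | e x y].

Definition sphere (T : finType) (e : rel T) (x : T) (i : nat) : {set T} :=
  [set y | gdist e x y == i].

Definition quadrangle (T : finType) (e : rel T) (p q r s : T) : Prop :=
  [/\ e p q, e q r, e r s & e s p] /\ [/\ gdist e p r = 2 & gdist e q s = 2].

Section GraphMetric.

Variables (T : finType) (e : rel T).
Hypotheses (e_sym : symmetric e) (e_irr : irreflexive e).
Hypothesis e_conn : connected_graph e.

Local Notation d := (gdist e).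

Lemma walkP (n : nat) (x y : T) :
  reflect (exists p, [/\ size p = n, path e x p & last x p = y]) (walk e n x y).
Proof.
apply: (iffP existsP) => [[p /andP[px /eqP py]]|[p [size_p px py]]].
  by exists p; rewrite size_tuple.
by exists (Tuple (introT eqP size_p)); rewrite /= px py eqxx.
Qed.

Lemma gdist_le_path (x : T) (p : seq T) : path e x p -> d x (last x p) <= size p.
Proof.
move=> px; rewrite leqNgt; apply/negP => lt_p.
have lt_pT : size p < #|T|.
  by rewrite (leq_trans lt_p)// /gdist (leq_trans (find_size _ _))// size_iota.
have := before_find 0 lt_p; rewrite nth_iota// add0n.
by have -> : walk e (size p) x (last x p) by apply/walkP; exists p.
Qed.

Lemma geodesicP (x y : T) :
  exists p, [/\ path e x p, last x p = y & size p = d x y].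
Proof.
have /connectP[p0 /shortenP[p px p_uniq _] ->] := e_conn x y.
have lt_pT : size p < #|T|.
  by have := max_card [in x :: p]; rewrite (card_uniqP p_uniq).
have walks : has (fun n => walk e n x (last x p)) (iota 0 #|T|).
  by apply/hasP; exists (size p); [rewrite mem_iota | apply/walkP; exists p].
have := nth_find 0 walks.
rewrite nth_iota; last by rewrite -{2}(size_iota 0 #|T|) -has_find.
by rewrite add0n => /walkP[q [size_q qx qy]]; exists q.
Qed.

Lemma gdistxx (x : T) : d x x = 0.
Proof. by apply/eqP; rewrite -leqn0; apply: (@gdist_le_path x [::]). Qed.

Lemma gdist_eq0 (x y : T) : (d x y == 0) = (x == y).
Proof.
apply/eqP/eqP => [dxy|->]; last exact: gdistxx.
by have [[|z p] [_ py]] := geodesicP x y; rewrite dxy.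
Qed.

Lemma gdist_triangle (y x z : T) : d x z <= d x y + d y z.
Proof.
have [p [px py <-]] := geodesicP x y; have [q [qy qz <-]] := geodesicP y z.
rewrite -size_cat -qz -py -last_cat; apply: gdist_le_path.
by rewrite cat_path px py.
Qed.

Lemma gdistC (x y : T) : d x y = d y x.
Proof.
suff le_sym u v : d u v <= d v u by apply/eqP; rewrite eqn_leq !le_sym.
have [p [pv pu <-]] := geodesicP v u.
have := @gdist_le_path u (rev (belast v p)).
rewrite -pu rev_path (eq_path (e' := e)) => [/(_ pv)|? ?]; last exact: e_sym.
rewrite size_rev size_belast.
by case: p {pv pu} => [|z p] //=; rewrite rev_cons last_rcons.
Qed.

Lemma gdist_eq1 (x y : T) : (d x y == 1) = e x y.
Proof.
apply/eqP/idP => [dxy|exy].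
  by have [[|z [|? ?]] [zP zy]] := geodesicP x y; rewrite dxy // -zy; case/andP: zP.
apply/eqP; rewrite eqn_leq lt0n gdist_eq0.
rewrite (@gdist_le_path x [:: y]) /= ?exy //.
by apply: contraTneq exy => ->; rewrite e_irr.
Qed.

Lemma gdist1 (x y : T) : e x y -> d x y = 1.
Proof. by rewrite -gdist_eq1 => /eqP. Qed.

Lemma gdist_adj (x y z : T) : e y z -> (d x z <= (d x y).+1) && (d x y <= (d x z).+1).
Proof.
move=> yz; have := gdist_triangle y x z; have := gdist_triangle z x y.
by rewrite [d z y]gdistC (gdist1 yz) !addn1 => -> ->.
Qed.

Lemma gdist_common_nbr (x y z : T) : e x z -> e y z -> d x y <= 2.
Proof.
move=> xz yz; have := gdist_triangle z x y.
by rewrite [d z y]gdistC (gdist1 xz) (gdist1 yz).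
Qed.

Lemma gdist_split (x y : T) (n : nat) :
  n <= d x y -> exists2 z, d x z = n & d z y = d x y - n.
Proof.
have [p [px py size_p]] := geodesicP x y; move=> le_n.
have := px; rewrite -(cat_take_drop n p) cat_path => /andP[take_x drop_z].
exists (last x (take n p)); move: (gdist_le_path take_x) (gdist_le_path drop_z);
  rewrite -last_cat cat_take_drop py size_drop size_takel size_p //;
  by have := gdist_triangle (last x (take n p)) x y; lia.
Qed.

Lemma gdist_pred (x y : T) (n : nat) : d x y = n.+1 -> exists2 z, e z y & d x z = n.
Proof.
move=> dxy; have [|z dxz dzy] := @gdist_split x y n; first by rewrite dxy.
by exists z => //; rewrite -gdist_eq1 dzy dxy subSnn.
Qed.

Lemma gdist_le_diameter (x y : T) : d x y <= diameter e.
Proof.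
apply: leq_trans (leq_bigmax_cond (P := predT) x isT).
exact: (leq_bigmax_cond (P := predT) (F := d x) y isT).
Qed.

Lemma ex_diameter : 0 < diameter e -> exists x y, d x y = diameter e.
Proof.
move=> D_gt0; have T_gt0 : 0 < #|T|.
  rewrite lt0n; apply: contraTneq D_gt0 => /card0_eq T0.
  by rewrite /diameter big_pred0.
have [x _ Dx] := eq_bigmax_cond (fun x => \max_y d x y) T_gt0.
have [y _ Dy] := eq_bigmax_cond (d x) T_gt0.
by exists x, y; rewrite -Dy -Dx.
Qed.

Lemma ex_gdist (i : nat) :
  0 < diameter e -> i <= diameter e -> exists x y, d x y = i.
Proof.
move=> /ex_diameter[x [y dxy]]; rewrite -dxy => /gdist_split[z dxz _].
by exists x, z.
Qed.

Lemma ex_quadrangle :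
  contains_quadrangle e -> exists p q r s, quadrangle e p q r s.
Proof.
move=> [h h_inj hE]; pose vertex i (lt_i4 : i < 4) := h (Ordinal lt_i4).
have gdist2 u v w : u != v -> ~~ e u v -> e u w -> e w v -> d u v = 2.
  move=> neq nadj uw wv; rewrite e_sym in wv; have := gdist_common_nbr uw wv.
  by move: neq nadj; rewrite -gdist_eq0 -gdist_eq1; lia.
exists (@vertex 0 isT), (@vertex 1 isT), (@vertex 2 isT), (@vertex 3 isT).
have [pq qr rs sp] : [/\ e (@vertex 0 isT) (@vertex 1 isT),
    e (@vertex 1 isT) (@vertex 2 isT), e (@vertex 2 isT) (@vertex 3 isT)
  & e (@vertex 3 isT) (@vertex 0 isT)] by rewrite /vertex !hE.
do 2!split=> //; [apply: gdist2 pq qr | apply: gdist2 qr rs];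
  by rewrite ?(inj_eq h_inj) ?hE.
Qed.

End GraphMetric.

(** * Double counting *)

Lemma sum_incidence (S U : finType) (A : {set S}) (B : {set U}) (R : U -> {set S}) :
  \sum_(x in A) #|[set y in B | x \in R y]| = \sum_(y in B) #|R y :&: A|.
Proof.
under eq_bigr do rewrite -sum1dep_card big_mkcondr.
rewrite exchange_big; apply: eq_bigr => y _; rewrite -big_mkcondr sum1dep_card.
by apply: eq_card => x; rewrite !inE andbC.
Qed.

Definition offdiag (S : finType) (A : {set S}) : {set S * S} :=
  [set uv in setX A A | uv.1 != uv.2].

Lemma card_offdiag (S : finType) (A : {set S}) : #|offdiag A| = #|A| * #|A|.-1.
Proof.
rewrite -sum1dep_card -sum_nat_const.
rewrite (eq_bigl (fun uv => (uv.1 \in A) && (uv.2 \in A :\ uv.1))); last first.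
  by move=> [u v]; rewrite !inE /= -andbA [v == u]eq_sym [RHS]andbCA andbA andbC.
rewrite -(pair_big_dep (mem A) (fun u v => v \in A :\ u) (fun _ _ => 1)).
by apply: eq_bigr => u uA; rewrite sum1_card (cardsD1 u A) [u \in A]uA.
Qed.

Lemma sum_offdiag_incidence (S U : finType) (A : {set S}) (B : {set U})
    (R : U -> {set S}) :
  \sum_(uv in offdiag A) #|[set y in B | (uv.1 \in R y) && (uv.2 \in R y)]|
  = \sum_(y in B) #|R y :&: A| * #|R y :&: A|.-1.
Proof.
transitivity (\sum_(uv in offdiag A) #|[set y in B | uv \in setX (R y) (R y)]|).
  by apply: eq_bigr => -[u v] _; apply: eq_card => y; rewrite !inE.
rewrite (sum_incidence _ _ (fun y => setX (R y) (R y))); apply: eq_bigr => y _.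
by rewrite -card_offdiag; apply: eq_card => -[u v]; rewrite !inE /= andbA andbACA.
Qed.

Section BoundedSums.

Variables (I : finType) (A : {set I}) (m n : I -> nat) (s : nat).
Hypothesis mn_le : forall i, i \in A -> m i + n i <= s.

Lemma sum_mul_le_pred : \sum_(i in A) m i * n i <= (\sum_(i in A) m i) * s.-1.
Proof.
rewrite big_distrl; apply: leq_sum => i /mn_le.
by case: (m i) => // k le_s; rewrite leq_mul2l; lia.
Qed.

Lemma sum_mul_AGM : 4 * \sum_(i in A) m i * n i <= s * \sum_(i in A) (m i + n i).
Proof.
rewrite !big_distrr; apply: leq_sum => i /mn_le le_s.
by apply: leq_trans (nat_AGM2 _ _).1 _; rewrite -mulnn leq_mul2r le_s orbT.
Qed.

End BoundedSums.

(* The hypothesis reads [2 B C (m - 2) <= m (C x + B y)], and [m <= B], [m <= C]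
   bound its right-hand side by [B C (x + y)]. *)
Lemma AGM_excess_le (B C m x y : nat) : 1 < m -> m <= B -> m <= C ->
  4 * (C * B * m.-1) <= m * (C * (B + x) + B * (C + y)) -> 2 * (m - 2) <= x + y.
Proof.
move=> m_gt1 le_mB le_mC agm.
rewrite -(leq_pmul2l (m := C * B)); last by rewrite muln_gt0; lia.
have Cx_le : m * (C * x) <= B * (C * x) by rewrite leq_mul2r le_mB orbT.
have By_le : m * (B * y) <= C * (B * y) by rewrite leq_mul2r le_mC orbT.
by case: m m_gt1 agm Cx_le By_le {le_mB le_mC} => [|[|m]] //= _; lia.
Qed.

(** * Regular graphs and the cube *)

Lemma card_nbrs_cube (n : nat) (f : {ffun 'I_n -> bool}) :
  #|nbrs (@cube_graph n) f| = n.
Proof.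
pose flip i : {ffun 'I_n -> bool} := [ffun j => f j (+) (j == i)].
have flip_inj : injective flip.
  move=> i j /ffunP/(_ i); rewrite !ffunE eqxx addbC [RHS]addbC => /addIb.
  by case: eqP.
rewrite -[RHS]card_ord -cardsT -(card_imset _ flip_inj); apply: eq_card => g.
rewrite inE; apply/cards1P/imsetP => [[i /setP diff_fg]|[i _ ->]].
  exists i => //; apply/ffunP => j; have := diff_fg j; rewrite !inE ffunE.
  by case: (f j); case: (g j); case: (j == i).
by exists i; apply/setP => j; rewrite !inE ffunE; case: (f j); case: (j == i).
Qed.

Section GraphMorphism.

Variables (T U : finType) (e : rel T) (f : rel U) (h : T -> U).

Lemma card_nbrs_bij (x : T) :
  bijective h -> (forall y z, f (h y) (h z) = e y z) -> #|nbrs e x| = #|nbrs f (h x)|.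
Proof.
move=> [g hK gK] hE; rewrite -(card_imset _ (can_inj hK)); apply: eq_card => u.
apply/imsetP/idP => [[y xy ->]|hu]; first by move: xy; rewrite !inE hE.
by exists (g u); rewrite ?gK // inE -hE gK; rewrite inE in hu.
Qed.

Lemma regular_morphism_reflects (k : nat) :
    injective h -> (forall x y, e x y -> f (h x) (h y)) ->
    (forall x, #|nbrs e x| = k) -> (forall u, #|nbrs f u| = k) ->
  forall x y, f (h x) (h y) = e x y.
Proof.
move=> h_inj h_morph e_reg f_reg x y.
have nbrs_hx : h @: nbrs e x = nbrs f (h x).
  apply/eqP; rewrite eqEcard card_imset // e_reg f_reg leqnn andbT.
  by apply/subsetP=> _ /imsetP[z xz ->]; rewrite inE in xz; rewrite inE h_morph.
by have := mem_imset (nbrs e x) y h_inj; rewrite nbrs_hx !inE.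
Qed.

End GraphMorphism.

(** * Intersection numbers *)

Section DistanceRegular.

Variables (T : finType) (e : rel T) (b c : nat -> nat).
Hypotheses (e_simple : simple_graph e) (e_drg : distance_regular_with e b c).

Local Notation d := (gdist e).
Local Notation D := (diameter e).
Local Notation nbrs := (nbrs e).
Local Notation sphere := (sphere e).

Hypothesis D_gt0 : 0 < D.

Let e_sym : symmetric e := e_simple.1.
Let e_irr : irreflexive e := e_simple.2.
Let e_conn : connected_graph e := e_drg.1.
Let gdist_eq0 := gdist_eq0 e_conn.
Let gdist_eq1 := gdist_eq1 e_irr e_conn.
Let gdist1 := gdist1 e_irr e_conn.
Let gdistC := gdistC e_sym e_conn.
Let gdist_triangle := gdist_triangle e_conn.
Let gdist_adj := gdist_adj e_sym e_irr e_conn.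
Let gdist_pred := gdist_pred e_irr e_conn.
Let ex_gdist i := @ex_gdist T e e_conn i D_gt0.

Definition intersection_a (i : nat) : nat := b 0 - (b i + c i).

Local Notation a := intersection_a.

Lemma nbrs_sphere1 (x : T) : nbrs x = sphere x 1.
Proof. by apply/setP=> y; rewrite !inE gdist_eq1. Qed.

Lemma card_nbrs_farther (x y : T) (i : nat) :
  d x y = i -> #|nbrs y :&: sphere x i.+1| = b i.
Proof.
move=> dxy; have le_iD : i <= D by rewrite -dxy gdist_le_diameter.
by rewrite -(e_drg.2 _ _ _ le_iD dxy).2; apply: eq_card => z; rewrite !inE.
Qed.

Lemma card_closer (x y : T) (i : nat) :
  d x y = i -> #|[set z | e y z & (d x z).+1 == i]| = c i.
Proof.
move=> dxy; have le_iD : i <= D by rewrite -dxy gdist_le_diameter.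
exact: (e_drg.2 _ _ _ le_iD dxy).1.
Qed.

Lemma card_nbrs_closer (x y : T) (i : nat) :
  d x y = i.+1 -> #|nbrs y :&: sphere x i| = c i.+1.
Proof. by move=> /card_closer <-; apply: eq_card => z; rewrite !inE eqSS. Qed.

Lemma card_nbrs (x : T) : #|nbrs x| = b 0.
Proof. by rewrite -(card_nbrs_farther (gdistxx e x)) nbrs_sphere1 setIid. Qed.

Lemma intersection_c0 : c 0 = 0.
Proof.
have [x [y dxy]] := ex_gdist (leq0n _).
by rewrite -(card_closer dxy); apply: eq_card0 => z; rewrite !inE andbF.
Qed.

Lemma intersection_c1 : c 1 = 1.
Proof.
have [x [y dxy]] := ex_gdist D_gt0.
rewrite -(card_nbrs_closer dxy) -(cards1 x); apply: eq_card => z.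
rewrite !inE gdist_eq0 eq_sym; have [->|] := eqVneq z x; last by rewrite andbF.
by rewrite e_sym -gdist_eq1 dxy.
Qed.

Lemma intersection_bD : b D = 0.
Proof.
have [x [y dxy]] := ex_gdist (leqnn _).
rewrite -(card_nbrs_farther dxy); apply: eq_card0 => z; rewrite !inE.
by have := gdist_le_diameter e x z; case: (e y z) => //=; lia.
Qed.

Lemma card_nbrs_split (x y : T) (i : nat) :
  d x y = i -> c i + #|nbrs y :&: sphere x i| + b i = b 0.
Proof.
move=> dxy; rewrite -(card_nbrs y) -(card_nbrs_farther dxy).
have -> : c i = #|nbrs y :\: (sphere x i :|: sphere x i.+1)|.
  rewrite -(card_closer dxy); apply: eq_card => z; rewrite !inE.
  case yz: (e y z); rewrite ?andbF ?andbT //=.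
  by have := gdist_adj x yz; rewrite dxy; lia.
rewrite -addnA -cardsUI -setIUr setIACA.
have -> : sphere x i :&: sphere x i.+1 = set0.
  by apply/setP=> z; rewrite !inE; lia.
by rewrite setI0 cards0 addn0 addnC cardsID.
Qed.

Lemma intersection_abc (i : nat) : i <= D -> a i + b i + c i = b 0.
Proof.
by move=> /ex_gdist[x [y /card_nbrs_split]]; rewrite /a; lia.
Qed.

Lemma card_nbrs_level (x y : T) (i : nat) :
  d x y = i -> #|nbrs y :&: sphere x i| = a i.
Proof. by move=> /card_nbrs_split; rewrite /a; lia. Qed.

Lemma intersection_array_unique (b' c' : nat -> nat) :
  distance_regular_with e b' c' -> forall i, i <= D -> c i = c' i /\ b i = b' i.
Proof.
move=> e_drg' i le_iD; have [x [y dxy]] := ex_gdist le_iD.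
by have [<- <-] := e_drg.2 _ _ _ le_iD dxy; have [<- <-] := e_drg'.2 _ _ _ le_iD dxy.
Qed.

Lemma intersection_b_gt0 (i : nat) : i < D -> 0 < b i.
Proof.
move=> /ex_gdist[x [y dxy]]; have [z zy dxz] := gdist_pred dxy.
by rewrite -(card_nbrs_farther dxz); apply/card_gt0P; exists y; rewrite !inE zy dxy /=.
Qed.

Lemma intersection_c_gt0 (i : nat) : i < D -> 0 < c i.+1.
Proof.
move=> /ex_gdist[x [y dxy]]; have [z zy dxz] := gdist_pred dxy.
rewrite -(card_nbrs_closer dxy); apply/card_gt0P; exists z.
by rewrite !inE e_sym zy dxz /=.
Qed.

(* If [w] lies at distance [i] from [x] on a geodesic from [x] to [y], the
   neighbours of [w] closer to [x] are farther from [y]. *)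
Lemma intersection_c_le_b (i j : nat) : i + j <= D -> c i <= b j.
Proof.
case: i => [|i] le_D; first by rewrite intersection_c0.
have [x [y dxy]] := ex_gdist le_D.
have [|w dxw dwy] := @gdist_split _ _ e_conn x y i.+1; first by rewrite dxy leq_addr.
have dyw : d y w = j by rewrite gdistC dwy dxy addKn.
rewrite -(card_nbrs_closer dxw) -(card_nbrs_farther dyw).
apply/subset_leq_card/subsetP => z; rewrite !inE => /andP[wz /eqP dxz].
rewrite wz /=; have := gdist_adj y wz; have := gdist_triangle z x y.
by rewrite [d z y]gdistC; lia.
Qed.

Lemma card_nbrsI_adj (x y : T) : e x y -> #|nbrs x :&: nbrs y| = a 1.
Proof. by move=> /gdist1/card_nbrs_level <-; rewrite setIC -nbrs_sphere1. Qed.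

Lemma card_nbrsI_gdist2 (x y : T) : d x y = 2 -> #|nbrs x :&: nbrs y| = c 2.
Proof. by move=> /card_nbrs_closer <-; rewrite setIC -nbrs_sphere1. Qed.

Lemma card_nbrsI_le (x y : T) : a 1 <= c 2 -> x != y -> #|nbrs x :&: nbrs y| <= c 2.
Proof.
move=> a1_le neq_xy; have [->|/set0Pn[z]] := eqVneq (nbrs x :&: nbrs y) set0.
  by rewrite cards0.
rewrite !inE => /andP[xz yz]; have := gdist_common_nbr e_sym e_irr e_conn xz yz.
case dxy: (d x y) => [|[|[|//]]] _.
- by move/eqP: dxy; rewrite gdist_eq0 (negPf neq_xy).
- by rewrite card_nbrsI_adj // -gdist_eq1 dxy.
- by rewrite card_nbrsI_gdist2.
Qed.

Lemma quadrangle_c2_gt1 (p q r s : T) : quadrangle e p q r s -> 1 < c 2.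
Proof.
move=> [[pq qr rs sp] [dpr dqs]]; rewrite -(card_nbrsI_gdist2 dpr).
have <- : #|[set q; s]| = 2 by rewrite cards2 -gdist_eq0 dqs.
apply/subset_leq_card/subsetP => z; rewrite !inE => /orP[] /eqP ->.
  by rewrite pq e_sym qr.
by rewrite e_sym sp rs.
Qed.

Lemma card_sphere_recurrence (x : T) (i : nat) :
  #|sphere x i| * b i = #|sphere x i.+1| * c i.+1.
Proof.
have := sum_incidence (sphere x i.+1) (sphere x i) nbrs.
rewrite [X in _ = X -> _](eq_bigr (fun _ => b i)) => [|u]; last first.
  by rewrite inE => /eqP/card_nbrs_farther.
rewrite (eq_bigr (fun _ => c i.+1)) => [|v]; last first.
  rewrite inE => /eqP/card_nbrs_closer <-; apply: eq_card => u.
  by rewrite !inE e_sym andbC.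
by rewrite !sum_nat_const.
Qed.

Lemma card_sphere0 (x : T) : #|sphere x 0| = 1.
Proof.
by rewrite -(cards1 x); apply: eq_card => y; rewrite !inE gdist_eq0 eq_sym.
Qed.

Lemma card_sphere_gt0 (x : T) (i : nat) : i <= D -> 0 < #|sphere x i|.
Proof.
elim: i => [|i IHi] lt_iD; first by rewrite card_sphere0.
have : 0 < #|sphere x i| * b i by rewrite muln_gt0 IHi ?intersection_b_gt0 // ltnW.
by rewrite card_sphere_recurrence muln_gt0 => /andP[].
Qed.

(** * Graphs with few triangles *)

Section Level.

Variables (x : T) (i : nat).

Let pairs := offdiag (sphere x i.+1).

Definition common_nbrs_on (j : nat) (uv : T * T) : {set T} :=
  [set w in sphere x j | (uv.1 \in nbrs w) && (uv.2 \in nbrs w)].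

Local Notation below := (common_nbrs_on i).
Local Notation above := (common_nbrs_on i.+2).

Lemma card_below_above_le (uv : T * T) :
  a 1 <= c 2 -> uv \in pairs -> #|below uv| + #|above uv| <= c 2.
Proof.
move=> a1_le; rewrite inE => /andP[_ /(card_nbrsI_le a1_le)]; apply: leq_trans.
rewrite -cardsUI [_ :&: above _](_ : _ = set0) ?cards0 ?addn0; last first.
  by apply/setP=> w; rewrite !inE; lia.
apply/subset_leq_card/subsetP => w; rewrite !inE ![e w _]e_sym.
by move=> /orP[] /andP[].
Qed.

Lemma sum_card_below :
  \sum_(uv in pairs) #|below uv| = #|sphere x i.+1| * (c i.+1 * (b i).-1).
Proof.
rewrite sum_offdiag_incidence mulnA -card_sphere_recurrence -mulnA -sum_nat_const.
by apply: eq_bigr => w; rewrite inE => /eqP/card_nbrs_farther ->.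
Qed.

Lemma sum_card_above :
  \sum_(uv in pairs) #|above uv| = #|sphere x i.+1| * (b i.+1 * (c i.+2).-1).
Proof.
rewrite sum_offdiag_incidence mulnA card_sphere_recurrence -mulnA -sum_nat_const.
by apply: eq_bigr => w; rewrite inE => /eqP/card_nbrs_closer ->.
Qed.

Let between (wz : T * T) : {set T} := nbrs wz.1 :&: nbrs wz.2.

Lemma card_between (wz : T * T) : wz \in setX (sphere x i) (sphere x i.+2) ->
  #|between wz :&: sphere x i.+1| = 0 \/ #|between wz :&: sphere x i.+1| = c 2.
Proof.
case: wz => w z; rewrite !inE /between /= => /andP[/eqP dxw /eqP dxz].
have dwz : 2 <= d w z by have := gdist_triangle w x z; lia.
have [gt2|le2] := ltnP 2 (d w z).
  left; apply: eq_card0 => u; rewrite !inE; apply/negP => /andP[/andP[wu zu] _].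
  by have := gdist_common_nbr e_sym e_irr e_conn wu zu; lia.
right; rewrite -(@card_nbrsI_gdist2 w z); last by lia.
apply: eq_card => u; rewrite !inE; apply: andb_idr => /andP[wu zu].
by have := gdist_adj x wu; have := gdist_adj x zu; lia.
Qed.

Lemma sum_card_between :
  \sum_(wz in setX (sphere x i) (sphere x i.+2)) #|between wz :&: sphere x i.+1|
  = #|sphere x i.+1| * (c i.+1 * b i.+1).
Proof.
rewrite -sum_incidence -sum_nat_const; apply: eq_bigr => u; rewrite inE => /eqP dxu.
rewrite -(card_nbrs_closer dxu) -(card_nbrs_farther dxu) -cardsX.
by apply: eq_card => -[w z]; rewrite !inE /= ![e _ u]e_sym [RHS]andbACA andbC.
Qed.

Lemma sum_card_below_above :
  \sum_(uv in pairs) #|below uv| * #|above uv|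
  = #|sphere x i.+1| * (c i.+1 * b i.+1 * (c 2).-1).
Proof.
transitivity (\sum_(uv in pairs) #|[set wz in setX (sphere x i) (sphere x i.+2)
    | (uv.1 \in between wz) && (uv.2 \in between wz)]|).
  apply: eq_bigr => uv _; rewrite -cardsX; apply: eq_card => -[w z].
  by rewrite !inE /= andbACA [X in _ && X]andbACA.
rewrite sum_offdiag_incidence mulnA -sum_card_between big_distrl.
by apply: eq_bigr => wz /card_between[] ->.
Qed.

End Level.

Section FewTriangles.

Hypotheses (a1_le_c2 : a 1 <= c 2) (c2_gt1 : 1 < c 2).

Lemma intersection_b_decr (i : nat) : i.+1 < D -> b i.+1 < b i.
Proof.
move=> iD; have [x _] := ex_diameter D_gt0.
have := sum_mul_le_pred (fun uv => @card_below_above_le x i uv a1_le_c2).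
rewrite sum_card_below_above sum_card_below -[X in _ <= X]mulnA leq_pmul2l; last first.
  by rewrite card_sphere_gt0 // ltnW.
rewrite -!mulnA leq_pmul2l ?intersection_c_gt0 //; last exact: ltnW.
by rewrite leq_pmul2r; have := intersection_b_gt0 (ltnW iD); lia.
Qed.

Lemma intersection_c_incr (i : nat) : i.+1 < D -> c i.+1 < c i.+2.
Proof.
move=> iD; have [x _] := ex_diameter D_gt0.
have card_above_below_le uv : uv \in offdiag (sphere x i.+1) ->
    #|common_nbrs_on x i.+2 uv| + #|common_nbrs_on x i uv| <= c 2.
  by rewrite addnC; apply: card_below_above_le.
have := sum_mul_le_pred card_above_below_le; under eq_bigr do rewrite mulnC.
rewrite sum_card_below_above sum_card_above -[X in _ <= X]mulnA leq_pmul2l; last first.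
  by rewrite card_sphere_gt0 // ltnW.
rewrite [c _ * _]mulnC -!mulnA leq_pmul2l ?intersection_b_gt0 //.
by rewrite leq_pmul2r; have := intersection_c_gt0 iD; lia.
Qed.

Lemma level_AGM (i : nat) : i.+1 < D ->
  4 * (c i.+1 * b i.+1 * (c 2).-1)
  <= c 2 * (c i.+1 * (b i).-1 + b i.+1 * (c i.+2).-1).
Proof.
move=> iD; have [x _] := ex_diameter D_gt0.
have := sum_mul_AGM (fun uv => @card_below_above_le x i uv a1_le_c2).
rewrite big_split sum_card_below_above sum_card_below sum_card_above /=.
rewrite -mulnDr mulnCA [X in _ <= X]mulnCA leq_pmul2l //.
by rewrite card_sphere_gt0 // ltnW.
Qed.

Lemma c2_le_c (i : nat) : 1 < i < D -> c 2 <= c i.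
Proof.
case/andP; elim: i => [//|i IHi]; rewrite ltnS leq_eqVlt => /predU1P[<- //|lt1i] iD.
apply: leq_trans (IHi lt1i (ltnW iD)) _.
by case: i lt1i iD {IHi} => // i _ /ltnW/intersection_c_incr/ltnW.
Qed.

Lemma intersection_growth (i : nat) : 0 < i -> i.+2 < D ->
  b i.+1 + c i.+1 + 2 * (c 2).-1 <= b i + c i.+2.
Proof.
move=> i_gt0 iD; have iD' := ltnW iD.
have b_ge : c 2 <= b i.+1 by apply: intersection_c_le_b; rewrite add2n.
have c_ge : c 2 <= c i.+1 by rewrite c2_le_c // ltnS i_gt0.
have [x b_x] : exists x, (b i).-1 = b i.+1 + x.
  by exists ((b i).-1 - b i.+1); have := intersection_b_decr iD'; lia.
have [y c_y] : exists y, (c i.+2).-1 = c i.+1 + y.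
  by exists ((c i.+2).-1 - c i.+1); have := intersection_c_incr iD'; lia.
have := level_AGM iD'; rewrite b_x c_y => /(AGM_excess_le c2_gt1 b_ge c_ge).
by lia.
Qed.

Lemma intersection_growth_sum (n : nat) : n.+2 < D ->
  b n.+1 + c 2 + n * (2 * (c 2).-1) <= b 1 + c n.+2.
Proof.
elim: n => [|n IHn] nD; first by rewrite addn0.
by have := IHn (ltnW nD); have := @intersection_growth n.+1 isT nD; lia.
Qed.

Lemma few_triangles_bound : 3 < D -> D * c 2 + (D - 4) * (c 2 - 2) <= 2 * b 0.
Proof.
move=> D_ge4; have [m Dm] : exists m, D = m.+4 by exists (D - 4); lia.
have growth : b m.+2 + c 2 + m.+1 * (2 * (c 2).-1) <= b 1 + c m.+3.
  by apply: intersection_growth_sum; rewrite Dm.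
have b_ge : c 2 <= b m.+2 by apply: intersection_c_le_b; rewrite Dm.
have b1_lt : b 1 < b 0 by have := intersection_abc D_gt0; rewrite intersection_c1; lia.
have c_lt : c m.+3 < b 0.
  have m3D : m.+3 < D by rewrite Dm.
  by have := intersection_abc (ltnW m3D); have := intersection_b_gt0 m3D; lia.
by rewrite Dm !subSS subn0; case: (c 2) c2_gt1 growth b_ge => [|[|t]] //=; lia.
Qed.

Lemma hadamard_of_c2_bound_eq : D = 4 -> D * c 2 = 2 * b 0 -> hadamard_graph e.
Proof.
move=> D4; have b_pos := intersection_b_gt0; have abc := intersection_abc.
have growth := intersection_growth_sum; have b2_ge := @intersection_c_le_b 2 2.
have b4 := intersection_bD; have c_incr := intersection_c_incr.
rewrite D4 in b_pos abc growth b2_ge b4 c_incr *; move=> eq_bound.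
have [b1E b2E b3E] : [/\ b 1 = (b 0).-1, b 2 = (b 0)./2 & b 3 = 1].
  have := abc 1 isT; have := abc 3 isT; have := b_pos 3 isT; have := growth 1 isT.
  by have := b2_ge isT; rewrite intersection_c1; split; lia.
have [c2E c3E c4E] : [/\ c 2 = (b 0)./2, c 3 = (b 0).-1 & c 4 = b 0].
  have := abc 3 isT; have := abc 4 isT; have := c_incr 2 isT; have := growth 1 isT.
  by rewrite b4 b1E b2E b3E; split; lia.
exists (b 0); first by lia.
split; rewrite ?D4 //; split=> // i x y le_iD dxy.
have [-> ->] := e_drg.2 _ _ _ le_iD dxy; move: le_iD; rewrite D4.
by case: i dxy => [|[|[|[|[|//]]]]] _ _; rewrite ?intersection_c0 ?intersection_c1.
Qed.

Lemma intersection_c_ge (i : nat) : i <= D -> i <= c i.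
Proof.
case: i => // i; elim: i => [|i IHi] iD; first by rewrite intersection_c1.
exact: leq_ltn_trans (IHi (ltnW iD)) (intersection_c_incr iD).
Qed.

Lemma intersection_b_ge (i : nat) : i <= D -> D - i <= b i.
Proof.
move=> le_iD; have := subnK le_iD; move: (D - i) => m.
elim: m i {le_iD} => [//|[|m] IHm] i im; first by rewrite intersection_b_gt0 -?im.
by apply: leq_ltn_trans (IHm i.+1 _) (intersection_b_decr _); lia.
Qed.

Lemma cube_array_of_c2_bound_eq : 4 < D -> D * c 2 = 2 * b 0 ->
  forall i, i <= D -> c i = i /\ b i = D - i.
Proof.
move=> D_gt4 eq_bound; have := few_triangles_bound (ltnW D_gt4).
rewrite eq_bound -[X in _ <= X]addn0 leq_add2l leqn0 muln_eq0 => c2_le2.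
have c2E : c 2 = 2 by lia.
have b0E : b 0 = D by move: eq_bound; rewrite c2E; lia.
move=> i le_iD; have := intersection_b_ge le_iD; have := intersection_abc le_iD.
by have := intersection_c_ge le_iD; rewrite b0E; lia.
Qed.

End FewTriangles.

(** * The adjacency algebra *)

Section AdjacencyAlgebra.

Import Order.TTheory GRing.Theory Num.Theory.
Local Open Scope ring_scope.

Variable F : numFieldType.
Implicit Types (f g : nat -> F) (M N : 'M[F]_#|T|).

Definition dist_mx g : 'M[F]_#|T| :=
  \matrix_(i, j) g (d (enum_val i) (enum_val j)).

Lemma dist_mxE g (x y : T) : dist_mx g (enum_rank x) (enum_rank y) = g (d x y).
Proof. by rewrite mxE !enum_rankK. Qed.

Lemma mul_dist_mxE f g (x y : T) :
  (dist_mx f *m dist_mx g) (enum_rank x) (enum_rank y) = \sum_u f (d x u) * g (d u y).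
Proof.
rewrite mxE (reindex enum_rank) /=; last first.
  by exists enum_val => u _; rewrite (enum_rankK, enum_valK).
by apply: eq_bigr => u _; rewrite !dist_mxE.
Qed.

Lemma eq_dist_mx f g : (forall h, (h <= D)%N -> f h = g h) -> dist_mx f = dist_mx g.
Proof. by move=> eq_fg; apply/matrixP=> i j; rewrite !mxE eq_fg ?gdist_le_diameter. Qed.

Lemma dist_mx_inj f g : dist_mx f = dist_mx g -> forall h, (h <= D)%N -> f h = g h.
Proof.
move=> eq_fg h le_hD; have [x [y <-]] := ex_gdist le_hD.
by rewrite -!dist_mxE eq_fg.
Qed.

Definition shell (i h : nat) : F := (h == i)%:R.

Definition ball (i h : nat) : F := (h <= i)%N%:R.

Lemma dist_mx_shell0 : dist_mx (shell 0) = 1%:M.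
Proof.
apply/matrixP=> i j; rewrite !mxE /shell gdist_eq0.
by rewrite (inj_eq enum_val_inj).
Qed.

Lemma dist_mx_ballS (i : nat) :
  dist_mx (ball i.+1) = dist_mx (ball i) + dist_mx (shell i.+1).
Proof.
apply/matrixP=> u v; rewrite !mxE /ball /shell -natrD; congr _%:R; lia.
Qed.

Definition laplacian g (h : nat) : F :=
  (c h)%:R * (g h - g h.-1) + (b h)%:R * (g h - g h.+1).

Definition laplacian_mx : 'M[F]_#|T| :=
  dist_mx (fun h => (b 0)%:R * shell 0 h - shell 1 h).

Lemma sum_nbrs_laplacian g (x y : T) :
  \sum_(u in nbrs x) (g (d x y) - g (d u y)) = laplacian g (d x y).
Proof.
move dyx: (d x y) => i; rewrite gdistC in dyx.
have le_iD : (i <= D)%N by rewrite -dyx gdist_le_diameter.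
have [closer farther] := e_drg.2 _ _ _ le_iD dyx.
have card_nbrs_in (P : pred T) :
    #|[set u | e x u & P u]|%:R = \sum_(u in nbrs x) (P u)%:R :> F.
  rewrite -sum1dep_card natr_sum big_mkcondr; apply: eq_big => [u|u _].
    by rewrite inE.
  by case: (P u).
rewrite /laplacian -closer -farther !card_nbrs_in !big_distrl -big_split.
apply: eq_bigr => u; rewrite inE /= gdistC => xu.
have := gdist_adj y xu; rewrite dyx; move: (d y u) => h near_h.
have [eq_h|[eq_h|eq_h]] : i = h.+1 \/ i = h \/ h = i.+1 by lia.
- by rewrite eq_h eqxx (ltn_eqF (leqnSn _)) /=; ring.
- by rewrite eq_h (gtn_eqF (ltnSn _)) (ltn_eqF (ltnSn _)) /=; ring.
- by rewrite eq_h eqxx (gtn_eqF (leqnSn _)) /=; ring.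
Qed.

Lemma mul_laplacian_mx g : laplacian_mx *m dist_mx g = dist_mx (laplacian g).
Proof.
apply/matrixP=> i j; rewrite -(enum_valK i) -(enum_valK j) mul_dist_mxE dist_mxE.
move: (enum_val i) (enum_val j) => x y {i j}.
rewrite -sum_nbrs_laplacian sumrB sumr_const card_nbrs -[g _ *+ _]mulr_natl.
under eq_bigr do rewrite mulrBl -mulrA.
rewrite sumrB -mulr_sumr (bigD1 x) //= big1 => [|u].
  rewrite /shell gdistxx eqxx mul1r addr0; congr (_ - _).
  rewrite nbrs_sphere1 [RHS]big_mkcond; apply: eq_bigr => u _.
  by rewrite inE; case: eqP; rewrite (mul0r, mul1r).
by rewrite /shell gdist_eq0 eq_sym => /negPf ->; rewrite mul0r.
Qed.

Lemma laplacian_ball (i h : nat) :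
  laplacian (ball i) h = (b i)%:R * shell i h - (c i.+1)%:R * shell i.+1 h.
Proof.
rewrite /laplacian /ball /shell; have [->|neq_i] := eqVneq h i.
  by rewrite leqnn leq_pred ltnn (ltn_eqF (ltnSn i)) /=; ring.
have [->|neq_iS] := eqVneq h i.+1.
  by rewrite leqnn ltnn (leqNgt i.+2) leqnSn /=; ring.
have [lt_hi|le_ih] := ltnP h i.
  by rewrite (ltnW lt_hi) (leq_trans (leq_pred h) (ltnW lt_hi)) /=; ring.
have [lt_ih lt_ih1] : (i < h)%N /\ (i < h.-1)%N by lia.
by rewrite (ltn_geF lt_ih1) (ltn_geF lt_ih) /=; ring.
Qed.

Definition radial M := exists g, M = dist_mx g.

Lemma radial0 : radial 0.
Proof. by exists (fun=> 0); apply/matrixP=> i j; rewrite !mxE. Qed.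

Lemma radialD M N : radial M -> radial N -> radial (M + N).
Proof.
move=> [f ->] [g ->]; exists (fun h => f h + g h).
by apply/matrixP=> i j; rewrite !mxE.
Qed.

Lemma radialZ (s : F) M : radial M -> radial (s *: M).
Proof.
by move=> [f ->]; exists (fun h => s * f h); apply/matrixP=> i j; rewrite !mxE.
Qed.

(* By [laplacian_ball], [c_(i+1) A_(i+1) = b_i A_i - L B_i] for the matrices [A_i]
   of the shells and [B_i] of the balls. *)
Lemma radial_ball_shell g (i : nat) : (i <= D)%N ->
  radial (dist_mx (ball i) *m dist_mx g) /\ radial (dist_mx (shell i) *m dist_mx g).
Proof.
elim: i => [|i IHi] le_iD.
  have -> : dist_mx (ball 0) = dist_mx (shell 0).
    by apply: eq_dist_mx => h _; rewrite /ball leqn0.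
  by rewrite dist_mx_shell0 mul1mx; split; exists g.
have [radB radS] := IHi (ltnW le_iD).
suff radSS : radial (dist_mx (shell i.+1) *m dist_mx g).
  by split=> //; rewrite dist_mx_ballS mulmxDl; apply: radialD.
have radLB : radial (laplacian_mx *m (dist_mx (ball i) *m dist_mx g)).
  by have [f ->] := radB; rewrite mul_laplacian_mx; eexists.
have c_neq0 : (c i.+1)%:R != 0 :> F by rewrite pnatr_eq0 -lt0n intersection_c_gt0.
have -> : dist_mx (shell i.+1) = (c i.+1)%:R^-1
    *: ((b i)%:R *: dist_mx (shell i) + -1 *: (laplacian_mx *m dist_mx (ball i))).
  apply/matrixP=> u v; rewrite mul_laplacian_mx !mxE laplacian_ball.
  by field.
rewrite -scalemxAl mulmxDl -!scalemxAl -mulmxA.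
by apply/radialZ/radialD; apply: radialZ.
Qed.

Lemma radial_mul_dist_mx f g : radial (dist_mx f *m dist_mx g).
Proof.
have -> : dist_mx f = \sum_(i < D.+1) f i *: dist_mx (shell i).
  apply/matrixP=> u v; rewrite summxE !mxE.
  have lt_dD : (d (enum_val u) (enum_val v) < D.+1)%N by rewrite ltnS gdist_le_diameter.
  rewrite (bigD1 (Ordinal lt_dD)) //= big1 => [|i neq_i].
    by rewrite !mxE /shell eqxx mulr1 addr0.
  by rewrite !mxE /shell eq_sym (negPf neq_i : (_ == _ :> nat) = _) mulr0.
rewrite mulmx_suml; apply: (big_ind radial) => [|M N|i _].
- exact: radial0.
- exact: radialD.
- by rewrite -scalemxAl; apply/radialZ/(radial_ball_shell g _).2; rewrite -ltnS.
Qed.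

Lemma dist_mxC f g : dist_mx f *m dist_mx g = dist_mx g *m dist_mx f.
Proof.
have tr_dist_mx h : (dist_mx h)^T = dist_mx h.
  by apply/matrixP=> i j; rewrite !mxE gdistC.
have [h fgE] := radial_mul_dist_mx f g.
by rewrite fgE -tr_dist_mx -fgE trmx_mul !tr_dist_mx.
Qed.

Lemma laplacian_distE (h : nat) : laplacian (fun i => i%:R) h = (c h)%:R - (b h)%:R.
Proof.
rewrite /laplacian -(natr1 h); case: h => [|h]; first by rewrite intersection_c0; ring.
by rewrite -(natr1 h) /=; ring.
Qed.

Lemma laplacian0 g : laplacian g 0 = (b 0)%:R * (g 0 - g 1).
Proof. by rewrite /laplacian intersection_c0 mul0r add0r. Qed.

Lemma mul_shell_diag f g (i : nat) (x : T) :
  dist_mx (shell i) *m dist_mx g = dist_mx f -> f 0 = #|sphere x i|%:R * g i.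
Proof.
move=> /(congr1 (fun M => M (enum_rank x) (enum_rank x))).
rewrite mul_dist_mxE dist_mxE gdistxx => <-.
rewrite mulr_natl -sumr_const [RHS]big_mkcond; apply: eq_bigr => u _.
by rewrite inE /shell [d u x]gdistC; case: eqP => [->|_]; rewrite (mul1r, mul0r).
Qed.

(* The Laplacian commutes with the shell, so the diagonal of their product with
   [dist_mx g] can be computed in two ways. *)
Lemma mul_shell_adj f g (i : nat) (x : T) :
  dist_mx (shell i) *m dist_mx g = dist_mx f ->
  (b 0)%:R * f 1 = #|sphere x i|%:R * ((b 0)%:R * g i - laplacian g i).
Proof.
move=> fE; have diag_f := mul_shell_diag x fE.
have diag_lap : laplacian f 0 = #|sphere x i|%:R * laplacian g i.
  by apply: mul_shell_diag; rewrite -!mul_laplacian_mx mulmxA -dist_mxC -mulmxA fE.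
by rewrite mulrBr -diag_lap laplacian0 diag_f; ring.
Qed.

Lemma laplacian_mul_ball f g (i : nat) :
  dist_mx (ball i) *m dist_mx g = dist_mx f -> exists f0 f1,
    [/\ dist_mx (shell i) *m dist_mx g = dist_mx f0,
        dist_mx (shell i.+1) *m dist_mx g = dist_mx f1
      & forall h, (h <= D)%N ->
          laplacian f h = (b i)%:R * f0 h - (c i.+1)%:R * f1 h].
Proof.
move=> fE; have [f0 f0E] := radial_mul_dist_mx (shell i) g.
have [f1 f1E] := radial_mul_dist_mx (shell i.+1) g.
exists f0, f1; split=> //; apply: (@dist_mx_inj _ (fun h => _ * f0 h - _ * f1 h)).
have -> : dist_mx (fun h => (b i)%:R * f0 h - (c i.+1)%:R * f1 h)
    = (b i)%:R *: dist_mx f0 - (c i.+1)%:R *: dist_mx f1.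
  by apply/matrixP=> u v; rewrite !mxE.
rewrite -f0E -f1E !scalemxAl -mulmxBl -mul_laplacian_mx -fE mulmxA; congr (_ *m _).
by rewrite mul_laplacian_mx; apply/matrixP=> u v; rewrite !mxE laplacian_ball.
Qed.

Lemma ball_dist_second_difference f (i : nat) (x : T) :
  dist_mx (ball i) *m dist_mx (fun h => h%:R) = dist_mx f ->
  (b 0)%:R * (b 1)%:R * (f 0 - 2 * f 1 + f 2)
  = #|sphere x i|%:R * (b i)%:R
    * ((b 0)%:R - (b 1)%:R + 1 + ((c i)%:R - (b i)%:R) - ((c i.+1)%:R - (b i.+1)%:R)).
Proof.
move=> /laplacian_mul_ball[f0 [f1 [f0E f1E lap_f]]].
have recurrence : #|sphere x i|%:R * (b i)%:R = #|sphere x i.+1|%:R * (c i.+1)%:R :> F.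
  by rewrite -!natrM card_sphere_recurrence.
have lap_f0 : laplacian f 0 = - (#|sphere x i|%:R * (b i)%:R).
  rewrite lap_f // (mul_shell_diag x f0E) (mul_shell_diag x f1E).
  by rewrite -(natr1 i); ring: recurrence.
have lap_f1 : (b 0)%:R * laplacian f 1 = #|sphere x i|%:R * (b i)%:R
    * (((c i.+1)%:R - (b i.+1)%:R) - ((c i)%:R - (b i)%:R) - (b 0)%:R).
  rewrite lap_f // mulrBr !(mulrCA (b 0)%:R).
  rewrite (mul_shell_adj x f0E) (mul_shell_adj x f1E).
  by rewrite !laplacian_distE -(natr1 i); ring: recurrence.
transitivity (((b 1)%:R - 1) * laplacian f 0 - (b 0)%:R * laplacian f 1).
  by rewrite laplacian0 /laplacian intersection_c1 /=; ring.
by rewrite lap_f0 lap_f1; ring.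
Qed.

End AdjacencyAlgebra.

(** * Terwilliger's inequality *)

Section Terwilliger.

Import Order.TTheory GRing.Theory Num.Theory.
Local Open Scope ring_scope.

Variables p q r s : T.
Hypothesis pqrs : quadrangle e p q r s.

Definition quad_alternating (f : nat -> rat) (u : T) : rat :=
  f (d p u) - f (d q u) + f (d r u) - f (d s u).

Lemma sum_quad_alternating (f g h : nat -> rat) :
  dist_mx f *m dist_mx g = dist_mx h ->
  \sum_u quad_alternating f u * quad_alternating g u = 4 * (h 0 - 2 * h 1 + h 2).
Proof.
move=> fgE; have [[pq qr rs sp] [dpr dqs]] := pqrs.
have entry x y : \sum_u f (d x u) * g (d y u) = h (d x y).
  rewrite -dist_mxE -fgE mul_dist_mxE.
  by apply: eq_bigr => u _; rewrite [d u y]gdistC.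
have row x : \sum_u f (d x u) * quad_alternating g u
    = h (d x p) - h (d x q) + h (d x r) - h (d x s).
  rewrite -!entry -!(sumrB, big_split) /=.
  by apply: eq_bigr => u _; rewrite /quad_alternating; ring.
transitivity (\sum_u f (d p u) * quad_alternating g u
    - \sum_u f (d q u) * quad_alternating g u + \sum_u f (d r u) * quad_alternating g u
    - \sum_u f (d s u) * quad_alternating g u).
  rewrite -!(sumrB, big_split) /=.
  by apply: eq_bigr => u _; rewrite [X in X * _]/quad_alternating; ring.
rewrite !row !gdistxx [d q p]gdistC [d r p]gdistC [d s q]gdistC.
rewrite [d r q]gdistC [d s r]gdistC [d p s]gdistC.
by rewrite !(gdist1 pq, gdist1 qr, gdist1 rs, gdist1 sp) dpr dqs; ring.
Qed.

(* Distances to consecutive vertices of the quadrangle differ by at most one,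
   so both factors cannot be nonzero of the same sign. *)
Lemma quad_alternating_ball_dist_le0 (i : nat) (u : T) :
  quad_alternating (ball rat i) u * quad_alternating (fun h => h%:R) u <= 0.
Proof.
have [[pq qr rs sp] _] := pqrs; have := gdist_adj u pq; have := gdist_adj u qr.
have := gdist_adj u rs; have := gdist_adj u sp.
rewrite /quad_alternating /ball ![d u _]gdistC.
move: (d p u) (d q u) (d r u) (d s u) => hp hq hr hs near_sp near_rs near_qr near_pq.
have : ((hp <= i)%N%:Z - (hq <= i)%N%:Z + (hr <= i)%N%:Z - (hs <= i)%N%:Z)
       * (hp%:Z - hq%:Z + hr%:Z - hs%:Z) <= 0.
  by case: (leqP hp i); case: (leqP hq i); case: (leqP hr i); case: (leqP hs i); lia.
by rewrite -(ler_int rat) !(rmorphM, rmorphB, rmorphD) /=.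
Qed.

Lemma terwilliger_step (i : nat) : (i < D)%N ->
  (c i + b i.+1 + (a 1).+2 <= c i.+1 + b i)%N.
Proof.
move=> lt_iD; have [f fE] := radial_mul_dist_mx (ball rat i) (fun h => h%:R).
have f_le0 : f 0 - 2 * f 1 + f 2 <= 0.
  have : 4 * (f 0 - 2 * f 1 + f 2) <= 0 :> rat.
    rewrite -(sum_quad_alternating fE).
    by apply: sumr_le0 => u _; apply: quad_alternating_ball_dist_le0.
  by rewrite pmulr_rle0.
have k_i_gt0 : 0 < #|sphere p i|%:R * (b i)%:R :> rat.
  by rewrite mulr_gt0 ?ltr0n ?card_sphere_gt0 ?intersection_b_gt0 // ltnW.
have := mulr_ge0_le0 (mulr_ge0 (ler0n rat (b 0)) (ler0n rat (b 1))) f_le0.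
rewrite (ball_dist_second_difference p fE) pmulr_rle0 //.
have := intersection_abc D_gt0; rewrite intersection_c1 => <-.
by rewrite -(ler_nat rat) -addn2 !natrD; lra.
Qed.

Lemma terwilliger_sum (n : nat) :
  (n <= D)%N -> (b n + n * (a 1).+2 <= b 0 + c n)%N.
Proof.
elim: n => [|n IHn] nD; first by rewrite addn0 leq_addr.
by have := IHn (ltnW nD); have := terwilliger_step nD; lia.
Qed.

Lemma terwilliger_bound : (D * (a 1).+2 <= 2 * b 0)%N.
Proof.
by have := terwilliger_sum (leqnn _); have := intersection_abc (leqnn D); lia.
Qed.

End Terwilliger.

(** * Recognising the cube *)

Section CubeArray.

Hypothesis cube_array : forall i, i <= D -> c i = i /\ b i = D - i.

Lemma cube_array_c (i : nat) : i <= D -> c i = i.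
Proof. by move=> /cube_array[]. Qed.

Lemma cube_array_b (i : nat) : i <= D -> b i = D - i.
Proof. by move=> /cube_array[]. Qed.

Lemma cube_array_bipartite (x v w : T) : e v w -> d x w != d x v.
Proof.
move=> vw; apply/negP => eq_d; have le_D := gdist_le_diameter e x v.
have := card_nbrs_split (erefl (d x v)).
rewrite (cube_array_c le_D) (cube_array_b le_D) cube_array_b // subn0.
suff : 0 < #|nbrs v :&: sphere x (d x v)| by lia.
by apply/card_gt0P; exists w; rewrite !inE vw.
Qed.

Lemma cube_array_card_sphere (x : T) (i : nat) : i <= D -> #|sphere x i| = 'C(D, i).
Proof.
elim: i => [|i IHi] lt_iD; first by rewrite card_sphere0 bin0.
have le_iD := ltnW lt_iD; have := card_sphere_recurrence x i.
rewrite IHi // cube_array_c // cube_array_b //.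
by rewrite mulnC -mul_bin_left mulnC => /eqP; rewrite eqn_pmul2r // => /eqP.
Qed.

Lemma cube_array_card : #|T| = 2 ^ D.
Proof.
have [x _] := ex_diameter D_gt0.
have -> : 2 ^ D = \sum_(i < D.+1) 'C(D, i).
  by rewrite (expnDn 1 1); apply: eq_bigr => i _; rewrite !exp1n !muln1.
rewrite -sum1_card (partition_big (fun y => inord (d x y) : 'I_D.+1) predT) //=.
apply: eq_bigr => i _; have le_iD : i <= D by rewrite -ltnS.
rewrite sum1dep_card -(cube_array_card_sphere x le_iD).
by apply: eq_card => y; rewrite !inE -val_eqE /= inordK // ltnS gdist_le_diameter.
Qed.

Section Coordinates.

Variables (x0 : T) (y : 'I_D -> T).
Hypotheses (y_inj : injective y) (nbrs_x0 : nbrs x0 = y @: setT).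

Let y_nbr i : e x0 (y i).
Proof. by have := imset_f y (in_setT i); rewrite -nbrs_x0 inE. Qed.

Definition coords (v : T) : {set 'I_D} := [set i | (d (y i) v).+1 == d x0 v].

Lemma card_coords (v : T) : #|coords v| = d x0 v.
Proof.
rewrite -(card_imset _ y_inj) -(cube_array_c (gdist_le_diameter e x0 v)).
rewrite -(card_closer (gdistC v x0)); apply: eq_card => z; rewrite inE.
apply/imsetP/andP => [[i + ->]|[x0z dvz]].
  by rewrite inE y_nbr gdistC => ->.
have : z \in nbrs x0 by rewrite inE.
rewrite nbrs_x0 => /imsetP[i _ z_i]; exists i => //.
by rewrite inE gdistC -z_i.
Qed.

Lemma coords_sub (v w : T) :
  e v w -> d x0 w = (d x0 v).+1 -> coords v \subset coords w.
Proof.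
move=> vw dw; apply/subsetP => i; rewrite !inE dw eqSS => /eqP iv.
have := gdist_triangle (y i) x0 w; rewrite (gdist1 (y_nbr i)) dw.
by have := gdist_adj (y i) vw; lia.
Qed.

(* Of the [d(x_0, v)] neighbours of [v] closer to [x_0], only [d(x_0, v) - 1] are
   closer to [y i]. *)
Lemma coords_remove (v : T) (i : 'I_D) :
  i \in coords v -> exists w, coords w = coords v :\ i.
Proof.
move=> iv; have := iv; rewrite inE => /eqP dyi.
have [w] : exists w, w \in [set w | e v w & (d x0 w).+1 == d x0 v]
    :\: [set w | e v w & (d (y i) w).+1 == d (y i) v].
  apply/set0Pn; rewrite -card_gt0 cardsD.
  apply: leq_trans (leq_sub2l _ (subset_leq_card (subsetIr _ _))).
  by rewrite !(card_closer (erefl _)) !cube_array_c ?gdist_le_diameter // -dyi subSnn.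
rewrite !inE => /andP[nyw /andP[vw /eqP dw]]; exists w.
apply/eqP; rewrite eqEcard [#|_ :\ i|]cardsDS ?sub1set // cards1.
rewrite !card_coords -dw subn1 leqnn andbT.
rewrite subsetD1 coords_sub ?dw // 1?e_sym // inE /=.
by move: nyw; rewrite vw /=; apply: contraNN => /eqP; lia.
Qed.

Lemma coords_surj (A : {set 'I_D}) : exists v, coords v = A.
Proof.
move: {2}(#|~: A|) (erefl #|~: A|) => n; elim: n A => [|n IHn] A cardA.
  have /card_gt0P[v] := card_sphere_gt0 x0 (leqnn D); rewrite inE => /eqP dv.
  have -> : A = setT by apply: setC_inj; rewrite setCT; apply: cards0_eq.
  by exists v; apply/eqP; rewrite eqEcard subsetT card_coords dv cardsT card_ord leqnn.
have /card_gt0P[i] : 0 < #|~: A| by rewrite cardA.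
rewrite inE => iA; have [|v coords_v] := IHn (i |: A).
  by rewrite setCU setIC -setDE cardsDS ?sub1set ?inE // cards1 cardA subn1.
have [|w coords_w] := @coords_remove v i; first by rewrite coords_v setU11.
by exists w; rewrite coords_w coords_v setU1K.
Qed.

Definition label (v : T) : {ffun 'I_D -> bool} := [ffun i => i \in coords v].

Lemma label_bij : bijective label.
Proof.
suff [g labelK] : exists g, cancel g label.
  have card_TU : #|T| = #|{ffun 'I_D -> bool}|.
    by rewrite cube_array_card card_ffun card_bool card_ord.
  apply: (bij_can_bij _ labelK); apply: inj_card_bij (can_inj labelK) _.
  by rewrite card_TU.
have label_surj (f : {ffun 'I_D -> bool}) : exists v, label v == f.
  have [v coords_v] := coords_surj [set i | f i].
  by exists v; apply/eqP/ffunP => i; rewrite ffunE coords_v inE.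
by exists (fun f => xchoose (label_surj f)) => f; apply/eqP/(xchooseP (label_surj f)).
Qed.

Lemma label_morphism (v w : T) : e v w -> cube_graph (label v) (label w).
Proof.
have label_up u1 u2 : e u1 u2 -> d x0 u2 = (d x0 u1).+1 ->
    #|[set i | label u1 i != label u2 i]| = 1.
  move=> u12 du; have /subsetP sub := coords_sub u12 du.
  rewrite -(subSnn (d x0 u1)) -du -!card_coords -cardsDS; last exact/subsetP.
  apply: eq_card => i; rewrite in_setD [LHS]inE !ffunE; have := sub i.
  case: (i \in coords u1) => [->//|_]; by case: (i \in coords u2).
move=> vw; rewrite /cube_graph; have := cube_array_bipartite x0 vw.
have := gdist_adj x0 vw => near neq.
have [dw|dv] : d x0 w = (d x0 v).+1 \/ d x0 v = (d x0 w).+1 by lia.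
  by rewrite label_up.
under eq_finset do rewrite eq_sym.
by rewrite label_up // e_sym.
Qed.

End Coordinates.

Lemma cube_array_iso : graph_iso e (@cube_graph D).
Proof.
have [x0 _] := ex_diameter D_gt0.
have card_nbrs_D x : #|nbrs x| = D by rewrite card_nbrs cube_array_b ?subn0.
pose y (i : 'I_D) := enum_val (cast_ord (esym (card_nbrs_D x0)) i).
have y_inj : injective y by move=> i j /enum_val_inj/cast_ord_inj.
have nbrs_x0 : nbrs x0 = y @: setT.
  apply/esym/eqP; rewrite eqEcard card_imset // cardsT card_ord card_nbrs_D leqnn andbT.
  by apply/subsetP=> _ /imsetP[i _ ->]; apply: enum_valP.
exists (label x0 y); first exact: label_bij.
apply: (regular_morphism_reflects _ _ card_nbrs_D (@card_nbrs_cube D)).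
  exact/bij_inj/label_bij.
exact: label_morphism.
Qed.

End CubeArray.

Lemma cube_valency : graph_iso e (@cube_graph D) -> b 0 = D.
Proof.
move=> [h h_bij hE]; have [x _] := ex_diameter D_gt0.
by rewrite -(card_nbrs x) (card_nbrs_bij x h_bij hE) card_nbrs_cube.
Qed.

(** * The bound and its equality case *)

Lemma c2_bound : 3 < D -> contains_quadrangle e -> D * c 2 <= 2 * b 0.
Proof.
move=> D_ge4 /(ex_quadrangle e_sym e_irr e_conn)[p [q [r [s pqrs]]]].
have [a1_le|a1_gt] := leqP (a 1) (c 2).
  apply: leq_trans (few_triangles_bound a1_le (quadrangle_c2_gt1 pqrs) D_ge4).
  exact: leq_addr.
by apply: leq_trans (terwilliger_bound pqrs); rewrite leq_mul2l; lia.
Qed.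

Lemma c2_bound_eq_classification :
  3 < D -> contains_quadrangle e -> D * c 2 = 2 * b 0 ->
  (D = 4 /\ hadamard_graph e) \/ (4 < D /\ graph_iso e (@cube_graph D)).
Proof.
move=> D_ge4 /(ex_quadrangle e_sym e_irr e_conn)[p [q [r [s pqrs]]]] eq_bound.
have a1_le : a 1 <= c 2.
  have := terwilliger_bound pqrs; rewrite -eq_bound leq_pmul2l //.
  by move=> /ltnW/ltnW.
have [D_eq4|D_neq4] := eqVneq D 4; [left | right].
  by split=> //; apply: hadamard_of_c2_bound_eq a1_le (quadrangle_c2_gt1 pqrs) _ _.
have D_gt4 : 4 < D by rewrite ltn_neqAle eq_sym D_neq4.
split=> //; apply: cube_array_iso.
exact: cube_array_of_c2_bound_eq a1_le (quadrangle_c2_gt1 pqrs) D_gt4 eq_bound.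
Qed.

Lemma hadamard_c2_bound_eq : D = 4 -> hadamard_graph e -> D * c 2 = 2 * b 0.
Proof.
move=> D4 [k k_even [_ _ e_drg']]; have array := intersection_array_unique e_drg'.
have [_ ->] := array 0 isT; have [|-> _] := array 2; first by rewrite D4.
by rewrite D4 /=; lia.
Qed.

Lemma cube_c2_bound_eq :
  3 < D -> contains_quadrangle e -> graph_iso e (@cube_graph D) ->
  D * c 2 = 2 * b 0.
Proof.
move=> D_ge4 quad /cube_valency b0E; have := c2_bound D_ge4 quad.
have [p [q [r [s /quadrangle_c2_gt1]]]] := ex_quadrangle e_sym e_irr e_conn quad.
rewrite b0E mulnC leq_pmul2r // => c2_gt1 c2_le2.
by congr (_ * _); lia.
Qed.

End DistanceRegular.

Import Order.TTheory GRing.Theory Num.Theory.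
Local Open Scope ring_scope.

Theorem theorem1 (T : finType) (e : rel T) (b c : nat -> nat) (k D : nat)
    (simple_e : simple_graph e)
    (drg_e : distance_regular_with e b c)
    (valency_e : b 0%N = k)
    (diameter_e : diameter e = D)
    (D_ge4 : (4 <= D)%N)
    (quad_e : contains_quadrangle e) :
  ((c 2%N)%:R : rat) <= 2 / D%:R * k%:R /\
  (((c 2%N)%:R : rat) = 2 / D%:R * k%:R <->
     (D = 4%N /\ hadamard_graph e) \/
     ((5 <= D)%N /\ graph_iso e (@cube_graph D))).
Proof.
subst k D; set D := diameter e in D_ge4 *.
have D_gt0 : (0 < D)%N by apply: leq_trans D_ge4.
have D_gt0Q : 0 < D%:R :> rat by rewrite ltr0n.
have boundE : 2 / D%:R * (b 0)%:R = (2 * b 0)%N%:R / D%:R :> rat.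
  by rewrite natrM mulrAC.
have eq_boundE : ((c 2)%:R = 2 / D%:R * (b 0)%:R :> rat) <-> (D * c 2 = 2 * b 0)%N.
  rewrite boundE; split=> [c2E|<-]; last by rewrite natrM mulrAC mulfV ?mul1r ?gt_eqF.
  by apply/eqP; rewrite -(eqr_nat rat) natrM c2E mulrC divfK // gt_eqF.
split.
  by rewrite boundE ler_pdivlMr // -natrM ler_nat mulnC (c2_bound simple_e drg_e).
rewrite eq_boundE; split; first exact: c2_bound_eq_classification.
case=> [[D_eq4 hadamard]|[_ cube]]; first exact: hadamard_c2_bound_eq.
exact: cube_c2_bound_eq.
Qed.
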